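(* Let $G$ be a compact Lie group and let $A:C^\infty(G)\to C^\infty(G)$ be a continuous linear operator with symbol $\sigma_A$. Then for every $x\in G$ and every irreducible unitary representation $\xi$ of $G$, $$\sigma_A(x,\xi)=\xi(x)^*(A\xi)(x).$$
   Context: $G$ carries its normalized bi-invariant Haar measure. $\mathrm{Rep}(G)$ is the set of strongly continuous irreducible unitary representations $\xi:G\to\mathcal U(\mathcal H_\xi)$ (finite-dimensional, smooth). The right-convolution kernel $R_A\in\mathcal D'(G\times G)$ of $A$ is defined by $Af(x)=\int_G f(y)\,R_A(x,y^{-1}x)\,dy$ in the sense of distributions, and the symbol of $A$ at $x\in G$, $\xi\in\mathrm{Rep}(G)$ is $\sigma_A(x,\xi)=\int_G R_A(x,y)\,\xi(y)^*\,dy\in\mathrm{End}(\mathcal H_\xi)$ in the sense of distributions. $A\xi$ is defined entrywise: writing $\xi$ as a matrix representation $\xi:G\to U(\dim\xi)$, $(A\xi)(x)_{mn}=(A(\xi_{mn}))(x)$, so that the identity reads $\sigma_A(x,\xi)_{mn}=\sum_{k}\overline{\xi_{km}(x)}\,(A\xi_{kn})(x)$. *)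

(* Defs.v *)
From HB Require Import structures.
From mathcomp Require Import all_boot all_order all_algebra.
From mathcomp Require Import spectral complex.
From mathcomp Require Import all_classical all_reals all_analysis.
Set Implicit Arguments.
Unset Strict Implicit.
Unset Printing Implicit Defensive.
Import Order.TTheory GRing.Theory Num.Theory.
Import numFieldNormedType.Exports.
Local Open Scope classical_set_scope.
Local Open Scope ring_scope.
Local Open Scope complex_scope.
Local Open Scope sesquilinear_scope.

Section SmoothOn.
Context {R : realType} {E F : normedModType R}.
Implicit Types (U : set E) (f g : E -> F) (vs : seq E).

(* [:: v1; ...; vk] |-> D_v1 (... (D_vk f)) *)
Definition iter_derive vs f : E -> F := foldr (fun v g => 'D_v g) f vs.

(* For U open and E finite dimensional this is C^oo on U: all iterated
   directional derivatives exist and are continuous on U. *)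
Definition smooth_on U f : Prop := forall vs x, U x ->
  {for x, continuous (iter_derive vs f)} /\
  (forall v, derivable (iter_derive vs f) x v).

Lemma smooth_on_cst0 U : smooth_on U (fun=> 0 : F).
Proof.
have D0 vs : iter_derive vs (fun=> 0 : F) = cst 0.
  by elim: vs => //= v vs ->; apply/funext => x; exact: derive_cst.
move=> vs x _; rewrite D0; split; first exact: cst_continuous.
by move=> v; exact: derivable_cst.
Qed.

Lemma iter_deriveD U f g : open U -> smooth_on U f -> smooth_on U g ->
  forall vs x, U x ->
    iter_derive vs (f + g) x = iter_derive vs f x + iter_derive vs g x.
Proof.
move=> oU sf sg; elim=> //= v vs IH x Ux.
rewrite -(deriveD ((sf vs x Ux).2 v) ((sg vs x Ux).2 v)).
by apply: near_eq_derive; near=> y; apply: IH; near: y; exact: open_nbhs_nbhs.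
Unshelve. all: by end_near. Qed.

Lemma smooth_onD U f g : open U -> smooth_on U f -> smooth_on U g ->
  smooth_on U (f + g).
Proof.
move=> oU sf sg vs x Ux.
have fgE : {near x,
    (iter_derive vs f + iter_derive vs g) =1 iter_derive vs (f + g)}.
  by near=> y; rewrite (iter_deriveD oU sf sg)//; near: y; exact: open_nbhs_nbhs.
split.
- rewrite /prop_for /continuous_at (iter_deriveD oU sf sg)//.
  apply: cvg_trans (near_eq_cvg fgE) _.
  by apply: cvgD; [exact: (sf vs x Ux).1|exact: (sg vs x Ux).1].
- move=> v; apply: (near_eq_derivable fgE).
  by apply: derivableD; [exact: (sf vs x Ux).2|exact: (sg vs x Ux).2].
Unshelve. all: by end_near. Qed.

Lemma iter_deriveZ U (a : R) f : open U -> smooth_on U f ->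
  forall vs x, U x -> iter_derive vs (a *: f) x = a *: iter_derive vs f x.
Proof.
move=> oU sf; elim=> //= v vs IH x Ux.
rewrite -(deriveZ _ ((sf vs x Ux).2 v)).
by apply: near_eq_derive; near=> y; apply: IH; near: y; exact: open_nbhs_nbhs.
Unshelve. all: by end_near. Qed.

Lemma smooth_onZ U (a : R) f : open U -> smooth_on U f -> smooth_on U (a *: f).
Proof.
move=> oU sf vs x Ux.
have fE : {near x, (a *: iter_derive vs f) =1 iter_derive vs (a *: f)}.
  by near=> y; rewrite (iter_deriveZ _ oU sf)//; near: y; exact: open_nbhs_nbhs.
split.
- rewrite /prop_for /continuous_at (iter_deriveZ _ oU sf)//.
  apply: cvg_trans (near_eq_cvg fE) _.
  by apply: cvgZr; exact: (sf vs x Ux).1.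
- move=> v; apply: (near_eq_derivable fE).
  by apply: derivableZ; exact: (sf vs x Ux).2.
Unshelve. all: by end_near. Qed.

End SmoothOn.

Section ComplexSmoothOn.
Context {R : realType} {E : normedModType R}.

Definition csmooth_on (U : set E) (f : E -> R[i]) : Prop :=
  smooth_on U (@complex.Re R \o f) /\ smooth_on U (@complex.Im R \o f).

Definition citer_derive (vs : seq E) (f : E -> R[i]) : E -> R[i]^o := fun x =>
  iter_derive vs (@complex.Re R \o f) x +i* iter_derive vs (@complex.Im R \o f) x.

End ComplexSmoothOn.

Record chart (R : realType) (M : topologicalType) (E : normedModType R) := Chart {
  chart_dom : set M;
  chart_map : M -> E;
  chart_inv : E -> M;
  chart_dom_open : open chart_dom;
  chart_img_open : open (chart_map @` chart_dom);
  chart_mapK : forall x, chart_dom x -> chart_inv (chart_map x) = x;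
  chart_map_continuous :
    forall x, chart_dom x -> {for x, continuous chart_map};
  chart_inv_continuous :
    forall u, (chart_map @` chart_dom) u -> {for u, continuous chart_inv} }.

Definition chart_img (R : realType) (M : topologicalType) (E : normedModType R)
  (c : chart M E) : set E := chart_map c @` chart_dom c.

Section Manifolds.
Context {R : realType}.

(* E is the model space; it is 'rV[R]_n for a group of dimension n, and
   'rV[R]_n * 'rV[R]_n for the square of such a group. *)
Definition smooth_atlas (M : topologicalType) (E : normedModType R)
    (A : set (chart M E)) : Prop :=
  (forall x, exists2 c, A c & chart_dom c x) /\
  (forall c d, A c -> A d ->
     smooth_on (chart_map c @` (chart_dom c `&` chart_dom d))
               (chart_map d \o chart_inv c)).

Definition smooth_map (M N : topologicalType) (E F : normedModType R)
    (A : set (chart M E)) (B : set (chart N F)) (f : M -> N) : Prop :=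
  continuous f /\
  (forall c d, A c -> B d ->
     smooth_on (chart_map c @` (chart_dom c `&` f @^-1` chart_dom d))
               (chart_map d \o f \o chart_inv c)).

Section ProductChart.
Context {M N : topologicalType} {E F : normedModType R}.
Variables (c : chart M E) (d : chart N F).

Let dom : set (M * N) := chart_dom c `*` chart_dom d.
Let map (p : M * N) : E * F := (chart_map c p.1, chart_map d p.2).
Let inv (u : E * F) : M * N := (chart_inv c u.1, chart_inv d u.2).

Let imgE : map @` dom = chart_img c `*` chart_img d.
Proof.
apply/seteqP; split => [_ [[x y] [/= cx dy] <-]|[u v] [/= [x cx <-] [y dy <-]]].
  by split; [exists x|exists y].
by exists (x, y).
Qed.

Let openX (T1 T2 : topologicalType) (A : set T1) (B : set T2) :
  open A -> open B -> open (A `*` B).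
Proof.
move=> oA oB; rewrite openE => -[x y] [/= Ax By].
by exists (A, B) => //; split; exact: open_nbhs_nbhs.
Qed.

Let dom_open : open dom.
Proof. by apply: openX; exact: chart_dom_open. Qed.

Let img_open : open (map @` dom).
Proof. by rewrite imgE; apply: openX; exact: chart_img_open. Qed.

Let mapK x : dom x -> inv (map x) = x.
Proof. by case: x => x y [/= cx dy]; rewrite /inv/= !chart_mapK. Qed.

Let map_cont x : dom x -> {for x, continuous map}.
Proof.
case: x => x y [/= cx dy]; apply: cvg_pair => /=.
- apply: (@cvg_comp _ _ _ fst (chart_map c) _ (nbhs x)).
    exact: cvg_fst.
  exact: chart_map_continuous.
- apply: (@cvg_comp _ _ _ snd (chart_map d) _ (nbhs y)).
    exact: cvg_snd.
  exact: chart_map_continuous.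
Qed.

Let inv_cont u : (map @` dom) u -> {for u, continuous inv}.
Proof.
rewrite imgE; case: u => u v [/= cu dv]; apply: cvg_pair => /=.
- apply: (@cvg_comp _ _ _ fst (chart_inv c) _ (nbhs u)).
    exact: cvg_fst.
  exact: chart_inv_continuous.
- apply: (@cvg_comp _ _ _ snd (chart_inv d) _ (nbhs v)).
    exact: cvg_snd.
  exact: chart_inv_continuous.
Qed.

Definition prod_chart : chart (M * N)%type (E * F)%type :=
  Chart dom_open img_open mapK map_cont inv_cont.

End ProductChart.

Definition prod_atlas (M N : topologicalType) (E F : normedModType R)
    (A : set (chart M E)) (B : set (chart N F)) :
    set (chart (M * N)%type (E * F)%type) :=
  [set prod_chart c d | c in A & d in B].

End Manifolds.

Section SmoothFunctions.
Context {R : realType} {M : topologicalType} {E : normedModType R}.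
Variable A : set (chart M E).

Definition smooth_function : {pred M -> R[i]^o} := fun f =>
  `[< forall c, A c -> csmooth_on (chart_img c) (f \o chart_inv c) >].

Lemma smooth_function_submod_closed : submod_closed smooth_function.
Proof.
split=> [|z f g /asboolP sf /asboolP sg]; apply/asboolP => c Ac.
  by split; exact: smooth_on_cst0.
have [sfr sfi] := sf c Ac; have [sgr sgi] := sg c Ac.
have oU : open (chart_img c) by exact: chart_img_open.
split.
- rewrite [X in smooth_on _ X](_ : _ =
    complex.Re z *: (@complex.Re R \o (f \o chart_inv c)) +
    (- complex.Im z) *: (@complex.Im R \o (f \o chart_inv c)) +
    (@complex.Re R \o (g \o chart_inv c))).
    exact: smooth_onD (smooth_onD oU (smooth_onZ _ oU sfr) (smooth_onZ _ oU sfi)) sgr.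
  apply/funext => u; rewrite !fctE /GRing.scale/= /GRing.add/=.
  by case: z (f _) (g _) => [a b] [p q] [r s] /=; rewrite mulNr.
- rewrite [X in smooth_on _ X](_ : _ =
    complex.Re z *: (@complex.Im R \o (f \o chart_inv c)) +
    complex.Im z *: (@complex.Re R \o (f \o chart_inv c)) +
    (@complex.Im R \o (g \o chart_inv c))).
    exact: smooth_onD (smooth_onD oU (smooth_onZ _ oU sfi) (smooth_onZ _ oU sfr)) sgi.
  apply/funext => u; rewrite !fctE /GRing.scale/= /GRing.add/=.
  by case: z (f _) (g _) => [a b] [p q] [r s] /=.
Qed.

HB.instance Definition _ := GRing.isSubmodClosed.Build R[i] (M -> R[i]^o)
  smooth_function smooth_function_submod_closed.

(* The space C^oo(M) of smooth complex-valued functions for the atlas A. *)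
Record Cinf := MkCinf {
  Cinf_fun :> M -> R[i]^o;
  Cinf_smooth : smooth_function Cinf_fun }.

HB.instance Definition _ := [isSub for Cinf_fun].
HB.instance Definition _ := [Choice of Cinf by <:].
HB.instance Definition _ := [SubChoice_isSubLmodule of Cinf by <:].

Record jet_index := JetIndex {
  jet_chart : chart M E;
  jet_chartP : A jet_chart;
  jet_set : set E;
  jet_compact : compact jet_set;
  jet_sub : jet_set `<=` chart_img jet_chart;
  jet_dirs : seq E }.

Definition jet (f : Cinf) :
    prod_topology (fun j : jet_index => {uniform` jet_set j -> R[i]^o}) :=
  fun j => citer_derive (jet_dirs j) (f \o chart_inv (jet_chart j)).

(* The Frechet topology of C^oo(M): uniform convergence, on the compact subsets
   of the images of the charts, of all derivatives in these charts. *)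
HB.instance Definition _ := Topological.copy Cinf (initial_topology jet).

(* Complex-linear continuous functionals on C^oo(M), for M compact. *)
Definition is_distribution (u : {linear Cinf -> R[i]^o}) : Prop := continuous u.

End SmoothFunctions.

HB.mixin Record isCompactLieGroup (R : realType) (n : nat) G
    of PointedTopological G & Group G := {
  lie_atlas : set (chart G 'rV[R]_n);
  lie_atlasP : smooth_atlas lie_atlas;
  lie_hausdorff : hausdorff_space G;
  lie_compact : compact [set: G];
  lie_mul_smooth : smooth_map (prod_atlas lie_atlas lie_atlas) lie_atlas
    (fun p : G * G => (p.1 * p.2)%g);
  lie_inv_smooth : smooth_map lie_atlas lie_atlas (fun x : G => x^-1%g) }.

(* Compact Lie groups of dimension n. Second countability is automatic. *)
#[short(type="compactLieGroupType")]
HB.structure Definition CompactLieGroup (R : realType) (n : nat) :=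
  { G of isCompactLieGroup R n G & PointedTopological G & Group G }.

Arguments lie_atlas {R n} s.

Notation "''C^oo' ( G )" := (Cinf (lie_atlas G))
  (format "''C^oo' ( G )") : type_scope.
Notation "''C^oo2' ( G )" := (Cinf (prod_atlas (lie_atlas G) (lie_atlas G)))
  (format "''C^oo2' ( G )") : type_scope.

Section Haar.
Context {R : realType} {n : nat} {G : compactLieGroupType R n}.

Definition borel := g_sigma_algebraType (@open G).

Definition bi_invariant (mu : set borel -> \bar R) : Prop :=
  forall (g : G) (B : set borel), measurable B ->
    mu [set (g * x)%g | x in B] = mu B /\ mu [set (x * g)%g | x in B] = mu B.

Definition cintegral (mu : {measure set borel -> \bar R}) (f : G -> R[i]) : R[i] :=
  (\int[mu]_(x in [set: borel]) complex.Re (f x)) +i*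
  (\int[mu]_(x in [set: borel]) complex.Im (f x)).

End Haar.
Arguments borel {R n} G.

(* Finite-dimensional irreducible unitary representations, written as matrices
   acting on column vectors. *)
Record unitary_irrep (R : realType) (n : nat) (G : compactLieGroupType R n)
    (d : nat) := UnitaryIrrep {
  rep :> G -> 'M[R[i]]_d;
  rep1 : rep 1%g = 1%:M;
  repM : forall x y, rep (x * y)%g = rep x *m rep y;
  rep_unitary : forall x, rep x \is unitarymx;
  rep_continuous : forall v : 'cV[R[i]^o]_d,
    continuous (fun x => rep x *m v : 'cV[R[i]^o]_d);
  rep_smooth : forall i j, smooth_function (lie_atlas G) (fun x => rep x i j);
  rep_dim_gt0 : (0 < d)%N;
  rep_irreducible : forall W : {vspace 'cV[R[i]]_d},
    (forall x v, v \in W -> rep x *m v \in W) -> W = 0%VS \/ W = fullv }.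

Section Symbol.
Context {R : realType} {n : nat} {G : compactLieGroupType R n}.
Variable mu : probability (borel G) R.

(* A f (x) = \int f(y) K(x, y^-1 x) dy weakly, i.e. after integration against
   phi(x) dx and the Haar measure preserving substitution z = y^-1 x:
     \int (A f)(x) phi(x) dx = << K(x, z), phi(x) f(x z^-1) >>.
   The test function Phi is smooth since the group operations are; quantifying
   over it spares a proof of smoothness inside the definition. *)
Definition right_convolution_kernel (A : 'C^oo(G) -> 'C^oo(G))
    (K : 'C^oo2(G) -> R[i]^o) : Prop :=
  forall (f phi : 'C^oo(G)) (Phi : 'C^oo2(G)),
    (forall x z, Phi (x, z) = phi x * f (x * z^-1)%g) ->
    cintegral mu (fun x => A f x * phi x) = K Phi.

Section SymbolOf.
Variables (K : 'C^oo2(G) -> R[i]^o) (d : nat) (xi : unitary_irrep G d).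

(* s(x) = \int K(x, y) (xi(y)^* )_(i, j) dy as distributions in x. *)
Definition is_symbol_entry (i j : 'I_d) (s : 'C^oo(G)) : Prop :=
  forall (phi : 'C^oo(G)) (Phi : 'C^oo2(G)),
    (forall x y, Phi (x, y) = phi x * ((xi y)^t*) i j) ->
    cintegral mu (fun x => s x * phi x) = K Phi.

(* When K is the right-convolution kernel of a continuous operator on C^oo(G),
   the distribution above is a unique smooth function, whence its values. *)
Definition symbol (x : G) : 'M[R[i]]_d :=
  \matrix_(i, j) (xget (0 : 'C^oo(G)) [set s | is_symbol_entry i j s] : 'C^oo(G)) x.

Definition rep_entry (i j : 'I_d) : 'C^oo(G) := MkCinf (rep_smooth xi i j).

Definition apply_rep (A : 'C^oo(G) -> 'C^oo(G)) (x : G) : 'M[R[i]]_d :=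
  \matrix_(i, j) A (rep_entry i j) x.

End SymbolOf.
End Symbol.

(* Main.v *)
Require Import Defs.
From mathcomp Require Import all_boot all_order all_algebra.
From mathcomp Require Import spectral complex.
From mathcomp Require Import all_classical all_reals all_analysis.
Set Implicit Arguments.
Unset Strict Implicit.
Unset Printing Implicit Defensive.
Import Order.TTheory GRing.Theory Num.Theory.
Import numFieldNormedType.Exports.
Local Open Scope classical_set_scope.
Local Open Scope ring_scope.
Local Open Scope complex_scope.
Local Open Scope sesquilinear_scope.

(** The symbol entry s(x) = sum_k conj(xi_ki(x)) (A xi_kj)(x) is characterised
by two facts.

It represents the distribution that defines the symbol. Against a test function
phi, the k-th summand is the pairing of A xi_kj with conj(xi_ki) phi, so the
kernel turns it into the value of K at
  (x, z) |-> conj(xi_ki(x)) phi(x) xi_kj(x z^-1).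
Since xi(x)^* xi(x z^-1) = xi(z)^* by multiplicativity and unitarity
([rep_adjoint_div]), these functions add up over k to phi(x) (xi(z)^* )_ij, and
additivity of K gives the claim ([is_symbol_entry_adjoint_apply]). The test
functions are smooth on G x G because xi_kj(x z^-1) = sum_l xi_kl(x)
conj(xi_jl(z)) makes them finite sums of tensor products
([smooth_function_tensor], [smooth_rep_div]).

It is the only smooth function that does, so that the choice made in [symbol]
returns it. If s and t represent the same distribution, then u = s - t is
orthogonal to every test function, in particular to conj(u), so the integral of
|u|^2 vanishes ([smooth_weak_eq]). Haar measure charges every nonempty open set:
finitely many translates of such a set cover the compact group, and they all
have the same measure ([haar_open_eq0]). As |u|^2 is continuous, u = 0. *)

(** * Calculus of smooth functions on normed spaces *)

(** Smoothness asks for all iterated derivatives, which are unwieldy to write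
down for a product. It is enough to exhibit a family of once-differentiable
functions that is stable, on the open set U, under directional derivatives;
every iterated derivative then stays in the family. *)
Lemma smooth_on_stable (R : realType) (E F : normedModType R) (U : set E)
    (P : set (E -> F)) : open U ->
  (forall f x, P f -> U x ->
     {for x, continuous f} /\ forall v, derivable f x v) ->
  (forall f v, P f -> exists2 g, P g & {in U, 'D_v f =1 g}) ->
  forall f, P f -> smooth_on U f.
Proof.
move=> oU Preg Pder f Pf.
have locE (g h : E -> F) x : {in U, g =1 h} -> U x -> \near x, g x = h x.
  move=> gh Ux; have : nbhs x U by exact: open_nbhs_nbhs.
  by apply: filterS => y Uy; apply: gh; rewrite inE.
have iterP vs : exists2 g, P g & {in U, iter_derive vs f =1 g}.
  elim: vs => [|v vs [g Pg fg]] /=; first by exists f.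
  have [h Ph gh] := Pder g v Pg; exists h => // x xU.
  rewrite -(gh x xU); apply: near_eq_derive; apply: locE => //; exact: set_mem.
move=> vs x Ux; have [g Pg fg] := iterP vs; have [gc gd] := Preg g x Pg Ux.
have gf : \near x, g x = iter_derive vs f x.
  by apply: locE => // y yU; rewrite (fg y yU).
split; last by move=> v; exact: near_eq_derivable gf (gd v).
rewrite /prop_for /continuous_at fg ?inE//.
exact: cvg_trans (near_eq_cvg gf) gc.
Qed.

Lemma smooth_on_derive (R : realType) (E F : normedModType R) (U : set E)
    (f : E -> F) (v : E) : smooth_on U f -> smooth_on U ('D_v f).
Proof.
move=> sf vs x Ux.
have -> : iter_derive vs ('D_v f) = iter_derive (rcons vs v) f.
  by rewrite /iter_derive foldr_rcons.
exact: sf.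
Qed.

(** By the Leibniz rule this family is stable under derivation, which individual
products are not. *)
Inductive sum_of_products (R : realType) (E : normedModType R) (U : set E) :
    (E -> R) -> Prop :=
  | product_sum_of_products (f g : E -> R) : smooth_on U f -> smooth_on U g ->
      sum_of_products U (f * g)
  | add_sum_of_products (f g : E -> R) :
      sum_of_products U f -> sum_of_products U g -> sum_of_products U (f + g).

Lemma smooth_onM (R : realType) (E : normedModType R) (U : set E)
    (f g : E -> R) : open U -> smooth_on U f -> smooth_on U g ->
  smooth_on U (f * g).
Proof.
move=> oU sf sg; apply: (@smooth_on_stable _ _ _ _ (sum_of_products U)) => //;
    last exact: product_sum_of_products.
- move=> h x; elim=> {h} [h k sh sk|h k _ IHh _ IHk] Ux.
    have [hc hd] := sh [::] x Ux; have [kc kd] := sk [::] x Ux.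
    by split=> [|v]; [exact: cvgM|exact: derivableM].
  have [hc hd] := IHh Ux; have [kc kd] := IHk Ux.
  by split=> [|v]; [exact: cvgD|exact: derivableD].
- have reg h x : sum_of_products U h -> U x -> forall v, derivable h x v.
    elim=> {h} [h k sh sk|h k _ IHh _ IHk] Ux v.
      by apply: derivableM; [exact: (sh [::] x Ux).2|exact: (sk [::] x Ux).2].
    by apply: derivableD; [exact: IHh|exact: IHk].
  move=> h v; elim=> {h} [h k sh sk|h k Ph [h' Ph' hh'] Pk [k' Pk' kk']].
    exists (h * 'D_v k + 'D_v h * k).
      exact: add_sum_of_products
        (product_sum_of_products sh (smooth_on_derive v sk))
        (product_sum_of_products (smooth_on_derive v sh) sk).
    move=> x; rewrite inE => Ux.
    rewrite deriveM; [|exact: (sh [::] x Ux).2|exact: (sk [::] x Ux).2].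
    by rewrite !fctE /GRing.scale/= [in X in _ + X]mulrC.
  exists (h' + k'); first exact: add_sum_of_products.
  move=> x xU; rewrite deriveD; [|exact: (reg _ _ Ph (set_mem xU))
    |exact: (reg _ _ Pk (set_mem xU))].
  by rewrite (hh' x xU) (kk' x xU).
Qed.

(** A directional derivative of f \o fst along v is that of f along v.1, by
conversion: the difference quotients are the same terms. *)
Lemma smooth_on_fst (R : realType) (E F V : normedModType R) (U : set (E * F))
    (W : set E) (f : E -> V) : U `<=` fst @^-1` W -> smooth_on W f ->
  smooth_on U (f \o fst).
Proof.
move=> UW sf vs p Up.
have -> : iter_derive vs (f \o fst) = iter_derive [seq v.1 | v <- vs] f \o fst.
  by elim: vs => //= v vs ->.
have [fc fd] := sf [seq v.1 | v <- vs] p.1 (UW p Up).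
split=> [|v]; last exact: fd v.1.
apply: (@cvg_comp _ _ _ fst _ _ (nbhs p.1)) => //; exact: cvg_fst.
Qed.

Lemma smooth_on_snd (R : realType) (E F V : normedModType R) (U : set (E * F))
    (W : set F) (f : F -> V) : U `<=` snd @^-1` W -> smooth_on W f ->
  smooth_on U (f \o snd).
Proof.
move=> UW sf vs p Up.
have -> : iter_derive vs (f \o snd) = iter_derive [seq v.2 | v <- vs] f \o snd.
  by elim: vs => //= v vs ->.
have [fc fd] := sf [seq v.2 | v <- vs] p.2 (UW p Up).
split=> [|v]; last exact: fd v.2.
apply: (@cvg_comp _ _ _ snd _ _ (nbhs p.2)) => //; exact: cvg_snd.
Qed.

(** * Smooth complex functions on manifolds *)

Section SmoothFunction.
Context {R : realType} {M : topologicalType} {E : normedModType R}.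
Variable A : set (chart M E).

Lemma smooth_functionM (f g : M -> R[i]^o) :
  f \in smooth_function A -> g \in smooth_function A ->
  (fun x => f x * g x) \in smooth_function A.
Proof.
move=> /asboolP sf /asboolP sg; apply/asboolP => c Ac.
have [fr fi] := sf c Ac; have [gr gi] := sg c Ac.
have oU : open (chart_img c) by exact: chart_img_open.
split.
- rewrite [X in smooth_on _ X](_ : _ =
    (@complex.Re R \o (f \o chart_inv c)) * (@complex.Re R \o (g \o chart_inv c))
    + (-1) *: ((@complex.Im R \o (f \o chart_inv c)) *
      (@complex.Im R \o (g \o chart_inv c)))).
    exact: smooth_onD (smooth_onM oU fr gr)
                      (smooth_onZ _ oU (smooth_onM oU fi gi)).
  apply/funext => u; rewrite scaleN1r !fctE /=.
  by case: (f _) (g _) => [a b] [p q].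
- rewrite [X in smooth_on _ X](_ : _ =
    (@complex.Re R \o (f \o chart_inv c)) * (@complex.Im R \o (g \o chart_inv c))
    + (@complex.Im R \o (f \o chart_inv c)) *
      (@complex.Re R \o (g \o chart_inv c))).
    exact: smooth_onD (smooth_onM oU fr gi) (smooth_onM oU fi gr).
  apply/funext => u; rewrite !fctE /=.
  by case: (f _) (g _) => [a b] [p q].
Qed.

Lemma smooth_functionC (f : M -> R[i]^o) :
  f \in smooth_function A -> (fun x => (f x)^*) \in smooth_function A.
Proof.
move=> /asboolP sf; apply/asboolP => c Ac; have [fr fi] := sf c Ac.
have oU : open (chart_img c) by exact: chart_img_open.
split.
- rewrite [X in smooth_on _ X](_ : _ = @complex.Re R \o (f \o chart_inv c))//.
  by apply/funext => u /=; case: (f _).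
- rewrite [X in smooth_on _ X](_ : _ =
    (-1) *: (@complex.Im R \o (f \o chart_inv c))).
    exact: smooth_onZ.
  by apply/funext => u; rewrite scaleN1r !fctE /=; case: (f _).
Qed.

Lemma smooth_function_sum (I : Type) (r : seq I) (f : I -> M -> R[i]^o) :
  (forall i, f i \in smooth_function A) ->
  (fun x => \sum_(i <- r) f i x) \in smooth_function A.
Proof. by move=> sf; rewrite -fct_sumE; apply: rpred_sum => i _. Qed.

(** Near a point of the domain of a chart c, f is the composite of its smooth
expression f \o chart_inv c with the continuous map chart_map c. *)
Lemma smooth_function_continuous (f : M -> R[i]^o) : smooth_atlas A ->
  f \in smooth_function A ->
  continuous (fun x => complex.Re (f x)) /\
  continuous (fun x => complex.Im (f x)).
Proof.
move=> [cover _] /asboolP sf.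
suff lift : forall (h : R[i] -> R) (c : chart M E) x, chart_dom c x ->
    smooth_on (chart_img c) (h \o (f \o chart_inv c)) ->
    {for x, continuous (h \o f)}.
  split=> x; have [c Ac cx] := cover x; have [fr fi] := sf c Ac;
    [exact: lift cx fr|exact: lift cx fi].
move=> h c x cx sh; have ix : chart_img c (chart_map c x) by exists x.
have [/= hc _] := sh [::] _ ix.
have cE : \near x, (h \o (f \o chart_inv c) \o chart_map c) x = (h \o f) x.
  have : nbhs x (chart_dom c).
    by apply: open_nbhs_nbhs; split => //; exact: chart_dom_open.
  by apply: filterS => y cy /=; rewrite chart_mapK.
rewrite /prop_for /continuous_at.
apply: cvg_trans (near_eq_cvg cE) _.
have -> : (h \o f) x = (h \o (f \o chart_inv c)) (chart_map c x).
  by rewrite /= chart_mapK.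
apply: (@cvg_comp _ _ _ (chart_map c) _ _ (nbhs (chart_map c x))) => //.
exact: chart_map_continuous.
Qed.

Definition Cinf_mul (f g : Cinf A) : Cinf A :=
  MkCinf (smooth_functionM (Cinf_smooth f) (Cinf_smooth g)).

Definition Cinf_conj (f : Cinf A) : Cinf A :=
  MkCinf (smooth_functionC (Cinf_smooth f)).

End SmoothFunction.

(** In a product chart, each factor is a function of one of the two coordinates
only. *)
Lemma smooth_function_tensor (R : realType) (M N : topologicalType)
    (E F : normedModType R) (A : set (chart M E)) (B : set (chart N F))
    (f : M -> R[i]^o) (g : N -> R[i]^o) :
  f \in smooth_function A -> g \in smooth_function B ->
  (fun p => f p.1 * g p.2) \in smooth_function (prod_atlas A B).
Proof.
move=> /asboolP sf /asboolP sg.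
apply: smooth_functionM; apply/asboolP => _ [c Ac [d Bd <-]].
- have [fr fi] := sf c Ac.
  have sub : chart_img (prod_chart c d) `<=` fst @^-1` chart_img c.
    by move=> _ [p [cp _] <-]; exists p.1.
  by split; [exact: smooth_on_fst sub fr|exact: smooth_on_fst sub fi].
- have [gr gi] := sg d Bd.
  have sub : chart_img (prod_chart c d) `<=` snd @^-1` chart_img d.
    by move=> _ [p [_ dp] <-]; exists p.2.
  by split; [exact: smooth_on_snd sub gr|exact: smooth_on_snd sub gi].
Qed.

(** * Haar measure and integration of smooth functions *)

Section HaarMeasure.
Context {R : realType} {n : nat} {G : compactLieGroupType R n}.
Implicit Type mu : probability (borel G) R.

Lemma open_borel_measurable (U : set G) : open U ->
  measurable (U : set (borel G)).
Proof. by move=> oU; exact: sub_sigma_algebra. Qed.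

Lemma translate_open (g : G) (U : set G) : open U ->
  open [set (g * x)%g | x in U].
Proof.
move=> oU.
have -> : [set (g * x)%g | x in U] = (fun y : G => (g^-1 * y)%g) @^-1` U.
  apply/seteqP; split=> [_ [x Ux <-]|y Uy] /=; first by rewrite mulKg.
  by exists (g^-1 * y)%g => //; rewrite mulVKg.
apply: open_comp oU => y _.
have [mul_cont _] := @lie_mul_smooth _ _ G.
apply: (@continuous_comp _ _ _ (fun y : G => (g^-1%g, y))
  (fun p : G * G => (p.1 * p.2)%g)).
  by apply: cvg_pair => /=; [exact: cvg_cst|exact: cvg_id].
exact: mul_cont.
Qed.

(** The translates of a nonempty open set cover the group, hence finitely many
do by compactness; were the set null, so would be the whole group. *)
Lemma haar_open_eq0 mu (U : set G) : bi_invariant mu -> open U ->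
  mu U = 0%E -> U = set0.
Proof.
move=> mu_haar oU mU0; apply/seteqP; split=> // a Ua.
have : cover_compact [set: G] by rewrite -compact_cover; exact: lie_compact.
move=> /(_ G [set: G] (fun g => [set (g * x)%g | x in U])).
case=> [g _|x _|D _ covD]; first exact: translate_open.
  by exists (x * a^-1)%g => //; exists a => //; rewrite mulgVK.
have mgU g : mu [set (g * x)%g | x in U] = 0%E.
  by have [-> _] := mu_haar g _ (open_borel_measurable oU).
move: covD (finite_fset D); set S := [set` _] => covS finS.
have : (mu [set: borel G] <= \sum_(g \in S) mu [set (g * x)%g | x in U])%E.
  apply: content_sub_fsum => //.
  by move=> g _; apply: open_borel_measurable; exact: translate_open.
rewrite fsbig1; last by move=> g _; exact: mgU.
by rewrite probability_setT lee_fin ler10.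
Qed.

Lemma continuous_integrable mu (f : G -> R) : continuous f ->
  mu.-integrable [set: borel G] (EFin \o f).
Proof.
move=> cf; apply: measurable_bounded_integrable => //.
- exact: le_lt_trans (probability_le1 mu measurableT) (ltry 1).
- apply: (measurability _ (measurable_realfun.RGenOpens.measurableE R)).
  move=> _ [_ [a [b ->] <-]]; rewrite setTI; apply: open_borel_measurable.
  by move/continuousP : cf; apply; exact: interval_open.
- have := @compact_bounded _ _ (f @` [set: G]).
  have cptf : compact (f @` [set: G]).
    apply: continuous_compact; last exact: lie_compact.
    exact: continuous_subspaceT.
  move=> /(_ cptf) [M [Mr fM]]; exists M; split=> // N MN x _.
  by apply: fM => //; exists x.
Qed.

(** The set where f is nonzero is open and, the integral being zero, null. *)
Lemma haar_integral_eq0 mu (f : G -> R) : bi_invariant mu -> continuous f ->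
  (forall x, 0 <= f x) -> \int[mu]_(x in [set: borel G]) f x = 0 ->
  forall x, f x = 0.
Proof.
move=> mu_haar cf f0 If0.
have intf := continuous_integrable mu cf.
have If0E : (\int[mu]_(x in [set: borel G]) `|(f x)%:E| = 0)%E.
  under eq_integral do rewrite gee0_abs ?lee_fin//.
  rewrite -[LHS]fineK ?integral_fune_fin_num//.
  by rewrite -[fine _]/(Rintegral _ _ _) If0.
have mf := measurable_int _ intf.
have [N [mN muN0 supN]] := (ae_eq_integral_abs mu measurableT mf).1 If0E.
have oU : open (f @^-1` [set y | y != 0]).
  by move/continuousP : cf; apply; exact: open_neq.
have U0 : f @^-1` [set y | y != 0] = set0.
  apply: (haar_open_eq0 mu_haar oU).
  apply/eqP; rewrite eq_le measure_ge0 andbT -muN0.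
  apply: le_measure; rewrite ?inE//; first exact: open_borel_measurable.
  by move=> x /eqP fx; apply: supN => /= /(_ I) [fx0]; exact: fx.
move=> x; apply/eqP; apply: contrapT => /negP fx.
by have : (f @^-1` [set y | y != 0]) x by []; rewrite U0.
Qed.

Lemma smooth_ReIm_continuous (f : 'C^oo(G)) :
  continuous (fun x => complex.Re (f x)) /\
  continuous (fun x => complex.Im (f x)).
Proof.
by apply: smooth_function_continuous; [exact: lie_atlasP|exact: Cinf_smooth].
Qed.

Lemma cintegralD mu (f g : 'C^oo(G)) :
  cintegral mu (fun x => f x + g x) = cintegral mu f + cintegral mu g.
Proof.
have [fr fi] := smooth_ReIm_continuous f.
have [gr gi] := smooth_ReIm_continuous g.
rewrite /cintegral /GRing.add/=; congr (_ +i* _).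
- rewrite -RintegralD//; [|exact: continuous_integrable..].
  by apply: eq_Rintegral => x _; case: (f x) (g x) => [a b] [p q].
- rewrite -RintegralD//; [|exact: continuous_integrable..].
  by apply: eq_Rintegral => x _; case: (f x) (g x) => [a b] [p q].
Qed.

Lemma cintegral0 mu : cintegral mu (fun x : G => 0) = 0.
Proof. by rewrite /cintegral /= /Rintegral !integral0. Qed.

Lemma cintegral_sum mu (I : Type) (r : seq I) (f : I -> 'C^oo(G)) :
  cintegral mu (fun x => \sum_(i <- r) f i x) =
  \sum_(i <- r) cintegral mu (f i).
Proof.
elim: r => [|i r IHr].
  rewrite big_nil -[RHS](cintegral0 mu); congr cintegral.
  by apply/funext => x; rewrite big_nil.
have sr : (fun x => \sum_(i <- r) f i x) \in smooth_function (lie_atlas G).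
  by apply: smooth_function_sum => j; exact: Cinf_smooth.
rewrite big_cons -IHr -(cintegralD _ _ (MkCinf sr)); congr cintegral.
by apply/funext => x; rewrite big_cons.
Qed.

(** Testing u = s - t against its own conjugate gives the integral of |u|^2. *)
Lemma smooth_weak_eq mu (s t : 'C^oo(G)) : bi_invariant mu ->
  (forall phi : 'C^oo(G), cintegral mu (fun x => s x * phi x) =
                          cintegral mu (fun x => t x * phi x)) ->
  s = t.
Proof.
move=> mu_haar st.
have [u sE] : exists u : 'C^oo(G), forall x, s x = u x + t x.
  by exists (s - t) => x; rewrite /= subrK.
pose phi := Cinf_conj u.
have I0 : cintegral mu (Cinf_mul u phi) = 0.
  apply: (addIr (cintegral mu (Cinf_mul t phi))); rewrite add0r -cintegralD -st.
  by congr cintegral; apply/funext => x; rewrite sE mulrDl.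
have normE x : complex.Re (Cinf_mul u phi x) =
    complex.Re (u x) ^+ 2 + complex.Im (u x) ^+ 2.
  by rewrite /=; case: (u x) => a b /=; rewrite mulrN opprK.
have u0 x : complex.Re (Cinf_mul u phi x) = 0.
  apply: (haar_integral_eq0 (f := fun x => complex.Re (Cinf_mul u phi x))
    mu_haar).
  - by have [] := smooth_ReIm_continuous (Cinf_mul u phi).
  - by move=> y; rewrite normE addr_ge0 ?sqr_ge0.
  - exact: (congr1 (@complex.Re R) I0).
apply: val_inj; apply/funext => x /=; rewrite sE.
have /eqP := u0 x; rewrite normE; case: (u x) => a b /=.
rewrite paddr_eq0 ?sqr_ge0// !sqrf_eq0 => /andP[/eqP-> /eqP->].
by rewrite add0r.
Qed.

End HaarMeasure.

(** * The entries of the symbol *)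

Section SymbolEntry.
Context {R : realType} {n : nat} {G : compactLieGroupType R n} {d : nat}.
Variable xi : unitary_irrep G d.

Lemma repV (x : G) : xi (x^-1)%g = (xi x)^t*.
Proof.
have /unitarymxP/mulmx1C xtx := rep_unitary xi x.
have xxV : xi x *m xi (x^-1)%g = 1%:M by rewrite -repM mulgV rep1.
by rewrite -[LHS]mul1mx -xtx -mulmxA xxV mulmx1.
Qed.

Lemma rep_divE (x z : G) (k j : 'I_d) :
  xi (x * z^-1)%g k j = \sum_l xi x k l * (xi z j l)^*.
Proof.
by rewrite repM repV mxE; apply: eq_bigr => l _; rewrite !mxE.
Qed.

(** The addition formula [rep_divE] separates the variables: the function is a
finite sum of tensor products of smooth functions on the factors. *)
Lemma smooth_rep_div (phi : 'C^oo(G)) (k j : 'I_d) :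
  (fun p : G * G => phi p.1 * xi (p.1 * p.2^-1)%g k j) \in
  smooth_function (prod_atlas (lie_atlas G) (lie_atlas G)).
Proof.
rewrite [X in X \in _](_ : _ = fun p => \sum_l
    Cinf_mul phi (rep_entry xi k l) p.1 * Cinf_conj (rep_entry xi j l) p.2).
  apply: smooth_function_sum => l.
  by apply: smooth_function_tensor; exact: Cinf_smooth.
apply/funext => p; rewrite rep_divE mulr_sumr.
by apply: eq_bigr => l _; rewrite mulrA.
Qed.

(** Unitarity of xi(x) cancels x in xi(x)^* xi(x z^-1) = xi(z^-1). This is why
the left factor xi(x)^* turns the matrix A xi into the symbol. *)
Lemma rep_adjoint_div (x z : G) (i j : 'I_d) :
  \sum_k (xi x k i)^* * xi (x * z^-1)%g k j = ((xi z)^t*) i j.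
Proof.
have /unitarymxP/mulmx1C xtx := rep_unitary xi x.
rewrite -repV -[xi (z^-1)%g]mul1mx -xtx -mulmxA -repM [RHS]mxE.
by apply: eq_bigr => k _; rewrite !mxE.
Qed.

Variable A : {linear 'C^oo(G) -> 'C^oo(G)}.

Definition adjoint_apply_entry (i j : 'I_d) : 'C^oo(G) :=
  MkCinf (smooth_function_sum (index_enum 'I_d) (fun k => Cinf_smooth
    (Cinf_mul (Cinf_conj (rep_entry xi k i)) (A (rep_entry xi k j))))).

(** The pairing with phi is split along k, so that the kernel applies to the
function xi_kj and the test function conj(xi_ki) phi for each k. *)
Lemma is_symbol_entry_adjoint_apply (mu : probability (borel G) R)
    (K : {linear 'C^oo2(G) -> R[i]^o}) (i j : 'I_d) :
  right_convolution_kernel mu A K ->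
  is_symbol_entry mu K xi i j (adjoint_apply_entry i j).
Proof.
move=> K_kernel phi Phi PhiE.
pose psi k := Cinf_mul (Cinf_conj (rep_entry xi k i)) phi.
pose Psi k : 'C^oo2(G) := MkCinf (smooth_rep_div (psi k) k j).
have -> : Phi = \sum_k Psi k.
  apply: val_inj; rewrite raddf_sum /=; apply/funext => -[x z].
  rewrite PhiE fct_sumE -(rep_adjoint_div x) mulr_sumr.
  by apply: eq_bigr => k _ /=; rewrite mulrA [phi x * _]mulrC.
rewrite raddf_sum.
transitivity (\sum_k cintegral mu (Cinf_mul (A (rep_entry xi k j)) (psi k))).
  rewrite -cintegral_sum; congr cintegral; apply/funext => x /=.
  rewrite mulr_suml; apply: eq_bigr => k _ /=.
  by rewrite mulrA [A _ x * _]mulrC.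
by apply: eq_bigr => k _; exact: K_kernel.
Qed.

End SymbolEntry.

(** The definition of a symbol entry only constrains those phi for which
phi(x) (xi(y)^* )_ij is smooth in (x, y); as a tensor product it always is. *)
Lemma is_symbol_entry_unique (R : realType) (n : nat)
    (G : compactLieGroupType R n) (mu : probability (borel G) R)
    (K : 'C^oo2(G) -> R[i]^o) (d : nat) (xi : unitary_irrep G d) (i j : 'I_d)
    (s t : 'C^oo(G)) : bi_invariant mu ->
  is_symbol_entry mu K xi i j s -> is_symbol_entry mu K xi i j t -> s = t.
Proof.
move=> mu_haar hs ht; apply: (smooth_weak_eq mu_haar) => phi.
pose Phi : 'C^oo2(G) := MkCinf (smooth_function_tensor (Cinf_smooth phi)
  (Cinf_smooth (Cinf_conj (rep_entry xi j i)))).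
have PhiE x y : Phi (x, y) = phi x * ((xi y)^t*) i j by rewrite !mxE.
by rewrite (hs phi Phi PhiE) (ht phi Phi PhiE).
Qed.

Unset Implicit Arguments.

Theorem theorem2p5 (R : realType) (n : nat) (G : compactLieGroupType R n)
  (mu : probability (borel G) R) (mu_haar : bi_invariant mu)
  (A : {linear 'C^oo(G) -> 'C^oo(G)}) (A_continuous : continuous A)
  (K : {linear 'C^oo2(G) -> R[i]^o}) (K_distribution : is_distribution K)
  (K_kernel : right_convolution_kernel mu A K)
  (x : G) (d : nat) (xi : unitary_irrep G d) :
  symbol mu K xi x = (xi x)^t* *m apply_rep xi A x.
Proof.
apply/matrixP => i j; rewrite !mxE.
have entryA : is_symbol_entry mu K xi i j (adjoint_apply_entry xi A i j).
  exact: is_symbol_entry_adjoint_apply.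
(* The default 0 of xget is never returned, since an entry exists. *)
have entryS := xgetPex 0 (ex_intro _ _ entryA).
rewrite (is_symbol_entry_unique mu_haar entryS entryA) /=.
by apply: eq_bigr => k _; rewrite !mxE.
Qed.
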